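(* Fix $n\ge416$, $M\ge\sqrt n$, let $m$ be the smallest integer with $m^2\ge4n/13$, and suppose that $n,M$ are large enough that $m\ge16$ and $M-1\ge2m$. Assume that the noise random variables $\xi_1,\ldots,\xi_n$ are i.i.d. $\mathcal{N}(0,\sigma^2)$, $\sigma>0$. Let $\eta\equiv0$ and let $f_1,\ldots,f_M$ be the dictionary defined in the context. Then the projection aggregate estimator $\mathsf{f}_{\lambda^{\mathrm{PROJ}}}$, where $\lambda^{\mathrm{PROJ}}\in\operatorname{argmin}_{\lambda\in\Lambda}\widehat{\operatorname{MSE}}(\mathsf{f}_\lambda)$, is such that $$\operatorname{MSE}(\mathsf{f}_{\lambda^{\mathrm{PROJ}}})\ge\min_{j=1,\ldots,M}\operatorname{MSE}(f_j)+\frac{\sigma^2}{\sqrt{48n}}$$ with probability larger than $1/4$. Moreover, this lower bound holds with arbitrarily large probability if $n$ is chosen large enough: for every $p<1$ there is $n_0$ such that for all $n\ge n_0$ and all $M$ satisfying $n\ge416$, $M\ge\sqrt n$, $m\ge16$ and $M-1\ge2m$ (where $m$ is the smallest integer with $m^2\ge4n/13$) the inequality $\operatorname{MSE}(\mathsf{f}_{\lambda^{\mathrm{PROJ}}})\ge\min_{j=1,\ldots,M}\operatorname{MSE}(f_j)+\frac{\sigma^2}{\sqrt{48n}}$ holds with probability at least $p$.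
   Context: Fixed design regression: $x_1,\ldots,x_n$ are design points in a set $\mathcal{X}$, and one observes $Y_i=\eta(x_i)+\xi_i$, $i=1,\ldots,n$. For $f:\mathcal{X}\to\mathbb{R}$: $\operatorname{MSE}(f)=\frac1n\sum_{i=1}^n(\eta(x_i)-f(x_i))^2$ and $\widehat{\operatorname{MSE}}(f)=\frac1n\sum_{i=1}^n(Y_i-f(x_i))^2$. $\Lambda=\{\lambda\in\mathbb{R}^M:\lambda_j\ge0,\ \sum_{j=1}^M\lambda_j=1\}$ and $\mathsf{f}_\lambda=\sum_{j=1}^M\lambda_jf_j$. Dictionary: identify $f_j$ with the vector $\mathfrak{f}_j=(f_j(x_1),\ldots,f_j(x_n))^\top\in\mathbb{R}^n$. Let $\mathsf{e}^{(1)},\ldots,\mathsf{e}^{(m)}$ be the first $m$ canonical basis vectors of $\mathbb{R}^n$. Set $\mathfrak{f}_j=\sigma\sqrt n\,\mathsf{e}^{(j)}$ for $1\le j\le m$; $\mathfrak{f}_j=-\sigma\sqrt n\,\mathsf{e}^{(j-m)}$ for $m+1\le j\le2m$; $\mathfrak{f}_{2m+1}=0$; and $\mathfrak{f}_j=\mathfrak{f}_1$ for $j>2m+1$. *)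

(* Defs.v *)
From HB Require Import structures.
From mathcomp Require Export all_boot all_order all_algebra.
From mathcomp Require Export all_classical all_reals all_analysis.

Set Implicit Arguments.
Unset Strict Implicit.
Unset Printing Implicit Defensive.

Import Order.TTheory GRing.Theory Num.Theory.
Local Open Scope classical_set_scope.
Local Open Scope ring_scope.

Section FixedDesign.
Variables (R : realType) (n : nat) (X : Type) (x : 'I_n -> X).

Definition MSE (eta f : X -> R) : R :=
  n%:R^-1 * \sum_(i < n) (eta (x i) - f (x i)) ^+ 2.

Definition empirical_MSE (Y : 'I_n -> R) (f : X -> R) : R :=
  n%:R^-1 * \sum_(i < n) (Y i - f (x i)) ^+ 2.

Definition observation (T : Type) (eta : X -> R) (xi : 'I_n -> T -> R)
  (w : T) (i : 'I_n) : R := eta (x i) + xi i w.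

Definition aggregate (M : nat) (f : 'I_M -> X -> R) (l : 'rV[R]_M) (z : X) : R :=
  \sum_(j < M) l ord0 j * f j z.

(* The minimum is taken in the extended reals only so that it is also defined
   for M = 0; it is a real number as soon as M > 0. *)
Definition min_MSE (M : nat) (eta : X -> R) (f : 'I_M -> X -> R) : \bar R :=
  \big[mine/+oo%E]_(j < M) (MSE eta (f j))%:E.

End FixedDesign.

Definition simplex (R : realType) (M : nat) : set 'rV[R]_M :=
  [set l | (forall j, 0 <= l ord0 j) /\ \sum_(j < M) l ord0 j = 1].

Definition argmin (R : realType) (V : Type) (A : set V) (g : V -> R) : set V :=
  [set v | A v /\ forall u, A u -> g v <= g u].

(* No measurability is required of the selection lam of a minimizer. *)
Definition is_projection_weight (R : realType) (n M : nat) (X T : Type)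
    (x : 'I_n -> X) (f : 'I_M -> X -> R) (Y : T -> 'I_n -> R)
    (lam : T -> 'rV[R]_M) : Prop :=
  forall w, argmin (@simplex R M)
    (fun l => empirical_MSE x (Y w) (aggregate f l)) (lam w).

Definition mutually_independent d (T : measurableType d) (R : realType)
    (P : probability T R) (n : nat) (xi : 'I_n -> {RV P >-> R}) : Prop :=
  forall (J : {set 'I_n}) (A : 'I_n -> set R),
    (forall i, i \in J -> measurable (A i)) ->
    P (\bigcap_(i in [set` J]) (xi i @^-1` A i)) =
      (\prod_(i in J) P (xi i @^-1` A i))%E.

(* [normal_prob] takes the standard deviation, not the variance. *)
Definition iid_centered_normal d (T : measurableType d) (R : realType)
    (P : probability T R) (n : nat) (xi : 'I_n -> {RV P >-> R}) (sigma : R)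
    : Prop :=
  mutually_independent xi /\
  forall (i : 'I_n) (A : set R), measurable A ->
    distribution P (xi i) A = normal_prob 0 sigma A.

Definition canonical_vector (R : realType) (n k : nat) : 'rV[R]_n :=
  \row_(i < n) (nat_of_ord i == k)%:R.

(* All indices are shifted down by one: j here is the index j + 1 of the
   dictionary numbered from 1, and [canonical_vector R n k] is e^(k+1). *)
Definition dictionary_vector (R : realType) (n m : nat) (sigma : R) (j : nat)
    : 'rV[R]_n :=
  let a := sigma * Num.sqrt n%:R in
  if (j < m)%N then a *: canonical_vector R n j
  else if (j < 2 * m)%N then - a *: canonical_vector R n (j - m)
  else if j == (2 * m)%N then 0
  else a *: canonical_vector R n 0.

Definition is_dictionary (R : realType) (n m M : nat) (sigma : R) (X : Type)
    (x : 'I_n -> X) (f : 'I_M -> X -> R) : Prop :=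
  forall (j : 'I_M) (i : 'I_n),
    f j (x i) = dictionary_vector n m sigma j ord0 i.

Definition is_least_m (R : realType) (n m : nat) : Prop :=
  let ok (k : nat) := 4 * n%:R / 13 <= k%:R ^+ 2 :> R in
  ok m /\ forall k : nat, ok k -> (m <= k)%N.

Definition admissible_sizes (R : realType) (n m M : nat) : Prop :=
  [/\ (416 <= n)%N, Num.sqrt n%:R <= M%:R :> R, is_least_m R n m,
      (16 <= m)%N & (2 * m <= M - 1)%N].

Definition lower_bound_event (R : realType) (n M : nat) (X T : Type)
    (x : 'I_n -> X) (eta : X -> R) (f : 'I_M -> X -> R) (sigma : R)
    (lam : T -> 'rV[R]_M) : set T :=
  [set w | (min_MSE x eta f + (sigma ^+ 2 / Num.sqrt (48 * n%:R))%:E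
             <= (MSE x eta (aggregate f (lam w)))%:E)%E].

(* Main.v *)
From HB Require Import structures.
Require Import Defs.
From mathcomp Require Import measurable_realfun zify ring lra.

Set Implicit Arguments.
Unset Strict Implicit.
Unset Printing Implicit Defensive.

Import Order.TTheory GRing.Theory Num.Theory.
Import numFieldNormedType.Exports.
Local Open Scope classical_set_scope.
Local Open Scope ring_scope.

(** At the design points the aggregates are exactly the vectors supported on
    the first m coordinates whose l1-norm is at most sigma sqrt n: a
    cross-polytope with the zero vector inside.  Since eta vanishes, the
    observations are pure noise, and projection aggregation is the Euclidean
    projection of the noise xi onto this cross-polytope, while the best element
    of the dictionary is 0 and has zero error.

    The size m is a small multiple of sqrt n, chosen so that the first m noise
    coordinates, whose l1-norm has order m sigma, typically lie inside the
    cross-polytope.  The projection then does not shrink them at all: the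
    aggregate reproduces them, and its error is Q / n where Q is the sum of
    xi_i^2 over i < m.  As Q is close to m sigma^2, this error has order
    sigma^2 / sqrt n.

    Quantitatively everything happens on the event |Q - m sigma^2| < m sigma^2 / 2
    ([lower_bound_deterministic]).  There the l1-norm is at most sqrt (m Q), hence
    at most sigma sqrt n because 3 m^2 <= 2 n, and the error is at least
    m sigma^2 / (2 n), hence at least sigma^2 / sqrt (48 n) because n <= 12 m^2;
    both inequalities come from the minimality of m
    ([admissible_sizes_bounds]).  The squares xi_i^2 have mean sigma^2 and
    variance 2 sigma^4, so Chebyshev's inequality gives the event probability at
    least 1 - 8 / m ([sum_sqr_normal_concentration]): this is at least 1/2 for
    m >= 16 and tends to 1 with n.

    The minimizing weights may be selected in a non-measurable way, but the
    fitted values they produce are unique and depend on the noise in a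
    1-Lipschitz way ([projection_contraction]).  Hence the complement of the
    lower bound event is open in the noise coordinates, and so measurable
    ([measurable_of_open_coordinates]). *)

(** * Second and fourth moments of the centered normal distribution *)

Section NormalMoments.
Context (R : realType).
Local Notation mu := (@lebesgue_measure R).
Implicit Types (s x : R) (k : nat).

(** The density agrees almost everywhere with the Radon-Nikodym derivative, for
    which the change of variables is known. *)
Lemma ge0_integral_normal_prob (m s : R) (f : R -> \bar R) :
  measurable_fun setT f -> (forall x, 0 <= f x)%E ->
  (\int[normal_prob m s]_x f x = \int[mu]_x (f x * (normal_pdf m s x)%:E))%E.
Proof.
move=> mf f0.
pose g := Radon_Nikodym_SigmaFinite.f (normal_prob m s) mu.
have dom := normal_prob_dominates m s.
rewrite -(Radon_Nikodym_SigmaFinite.change_of_variables dom f0 measurableT mf).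
have mpdf : measurable_fun setT (EFin \o normal_pdf m s).
  by apply/measurable_EFinP; exact: measurable_normal_pdf.
have ig := Radon_Nikodym_SigmaFinite.f_integrable dom.
have gE : ae_eq mu setT g (EFin \o normal_pdf m s).
  apply: (integral_ae_eq measurableT ig mpdf) => A _ mA.
  by rewrite -Radon_Nikodym_SigmaFinite.f_integral.
apply: ae_eq_integral => //.
- exact: emeasurable_funM (measurable_int _ ig).
- exact: emeasurable_funM.
- by apply: filterS gE => x /= gx _; rewrite -/g gx.
Qed.

(** Bounding the exponential below by the term of degree [k + 1] of its series
    at [x ^ 2 / (2 s ^ 2)] leaves a factor [x ^ (- k - 2)], more than needed. *)
Lemma cvg_monomial_normal_fun s k : s != 0 ->
  x ^+ k * normal_fun 0 s x @[x --> +oo] --> 0.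
Proof.
move=> s0.
pose c : R := (s ^+ 2 *+ 2) ^+ k.+1 * k.+1`!%:R.
have s2 : 0 < s ^+ 2 *+ 2 by rewrite pmulrn_lgt0// exprn_even_gt0.
apply: (@squeeze_cvgr _ _ _ _ (cst 0) (fun x => c * x^-1)).
- near=> x.
  have x1 : 1 <= x by near: x; exact: nbhs_pinfty_ge.
  have x0 : 0 < x by exact: lt_le_trans x1.
  rewrite /cst mulr_ge0 ?exprn_ge0 ?normal_fun_ge0 ?(ltW x0)//=.
  rewrite /normal_fun subr0 mulNr expRN ler_pdivrMr ?expR_gt0//.
  set y := x ^+ 2 / _.
  have y0 : 0 <= y by rewrite divr_ge0 ?sqr_ge0// ltW.
  have : y ^+ k.+1 / k.+1`!%:R <= expR y.
    by apply: le_trans (expR_ge1Dxn k y0); rewrite lerDr.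
  rewrite ler_pdivrMr ?ltr0n ?fact_gt0// => yk.
  have yE : y ^+ k.+1 * (s ^+ 2 *+ 2) ^+ k.+1 = x ^+ k.+2 * x ^+ k.
    rewrite -exprMn /y divfK ?gt_eqF// -exprM -exprD; congr (x ^+ _).
    by rewrite mul2n -addnn addnS !addSn.
  (* Multiplying both sides by x^(k+2) makes y^(k+1) appear on the left; the
     surplus factor x^(k+1) on the right is discarded using 1 <= x. *)
  rewrite -(ler_pM2l (exprn_gt0 k.+2 x0)) -yE.
  apply: (@le_trans _ _ (expR y * k.+1`!%:R * (s ^+ 2 *+ 2) ^+ k.+1)).
    by rewrite ler_pM2r// exprn_gt0.
  have -> : x ^+ k.+2 * (c / x * expR y) = x ^+ k.+1 * (c * expR y).
    by rewrite exprS; field; rewrite gt_eqF.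
  rewrite /c -[leLHS]mul1r; apply: ler_pM => //.
  - by rewrite !mulr_ge0 ?expR_ge0 ?exprn_ge0// ltW.
  - exact: exprn_ege1.
  - by rewrite mulrC mulrCA mulrC -mulrA.
- exact: cvg_cst.
- rewrite -(mulr0 c); apply: cvgM; first exact: cvg_cst.
  apply/gtr0_cvgV0; last exact: cvg_id.
  exact: nbhs_pinfty_gt.
Unshelve. all: by end_near. Qed.

Definition monomial_pdf s k x := x ^+ k * normal_pdf 0 s x.

Lemma continuous_monomial_pdf s k : s != 0 -> continuous (monomial_pdf s k).
Proof.
move=> s0 x; apply: cvgM; first exact: exprn_continuous.
exact: continuous_normal_pdf.
Qed.

Lemma cvg_monomial_pdf s k : s != 0 -> monomial_pdf s k x @[x --> +oo] --> 0.
Proof.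
move=> s0.
have -> : monomial_pdf s k = (fun x => normal_peak s * (x ^+ k * normal_fun 0 s x)).
  by apply/funext => x; rewrite /monomial_pdf normal_pdfE// mulrCA.
rewrite -[X in _ --> X](mulr0 (normal_peak s)); apply: cvgM; first exact: cvg_cst.
exact: cvg_monomial_normal_fun.
Qed.

(** The density satisfies [p' = - x p / s ^ 2], so differentiating
    [- s ^ 2 x ^ (k + 1) p] relates the moments of orders [k + 2] and [k]. *)
Lemma is_derive_monomial_pdf s k x : s != 0 ->
  is_derive x 1 (fun x => - s ^+ 2 * monomial_pdf s k.+1 x)
    (monomial_pdf s k.+2 x - k.+1%:R * s ^+ 2 * monomial_pdf s k x).
Proof.
move=> s0; rewrite /monomial_pdf normal_pdfE// /normal_fun.
have E y : expR (- (s ^+ 2 *+ 2)^-1 * y ^+ 2) =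
    expR (- y ^+ 2 / (s ^+ 2 *+ 2)) by congr expR; ring.
have -> : (fun x => - s ^+ 2 * (x ^+ k.+1 * (normal_peak s *
    expR (- (x - 0) ^+ 2 / (s ^+ 2 *+ 2))))) =
  (- s ^+ 2 * normal_peak s) \*: ((id ^+ k.+1) *
    (expR \o ((- (s ^+ 2 *+ 2)^-1) \*: (id ^+ 2)))).
  apply/funext => y /=; rewrite subr0 !fctE/= /GRing.scale/= -E; ring.
apply: is_derive_eq; rewrite !fctE/= /GRing.scale/= subr0 expr1 !E mulr1 !exprS.
by field; rewrite s0.
Qed.

Lemma ge0_integral_itv_cat (a b : R) (f : R -> R) :
  a <= b -> continuous f -> (forall x, a <= x -> 0 <= f x) ->
  (\int[mu]_(x in `[a, +oo[) (f x)%:E =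
   \int[mu]_(x in `[a, b]) (f x)%:E + \int[mu]_(x in `[b, +oo[) (f x)%:E)%E.
Proof.
move=> ab cf f0.
have mf : measurable_fun setT f by exact: continuous_measurable_fun.
have mEf : measurable_fun setT (EFin \o f) by exact/measurable_EFinP.
have -> : `[a, +oo[%classic = `[a, b] `|` `]b, +oo[ :> set R.
  by rewrite -itv_bndbnd_setU.
rewrite ge0_integral_setU//=.
- by rewrite integral_itv_obnd_cbnd//; exact: measurable_funTS.
- exact: measurable_funTS.
- move=> x []; rewrite /= in_itv/= => /andP[ax _]; rewrite lee_fin f0//.
  by rewrite ltW// (le_lt_trans ab).
- apply/disj_setPS => x /= []; rewrite !in_itv/= => /andP[_ xb] /andP[bx _].
  by rewrite ltNge xb in bx.
Qed.

Lemma ge0_integral_subK (D : set R) (f g : R -> R) : measurable D ->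
  continuous f -> continuous g ->
  (forall x, D x -> 0 <= (f - g) x) -> (forall x, D x -> 0 <= g x) ->
  (\int[mu]_(x in D) (f x)%:E =
   \int[mu]_(x in D) ((f - g) x)%:E + \int[mu]_(x in D) (g x)%:E)%E.
Proof.
move=> mD cf cg fg0 g0.
have mE h : continuous h -> measurable_fun D (EFin \o h : R -> \bar R).
  move=> ch; apply: measurable_funTS; apply/measurable_EFinP.
  exact: continuous_measurable_fun.
rewrite -ge0_integralD//=.
- by apply: eq_integral => x _; rewrite -EFinD subrK.
- by apply: (mE (f - g)) => x; apply: cvgB; [exact: cf|exact: cg].
- exact: mE.
Qed.

(** Integration by parts on a half-line, organised so as to use only integrals
    of nonnegative functions.  With [F = - s ^ 2 x ^ (k + 1) p], the derivative
    [F' = G - H], where [G = x ^ (k + 2) p] and [H = (k + 1) s ^ 2 x ^ k p], changes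
    sign exactly once, at [a = |s| sqrt (k + 1)], and [F] vanishes at both ends.
    So [H - G] from 0 to [a] and [G - H] from [a] to infinity have the same
    integral [- F a]: the deficit of [G] before [a] is its excess after [a]. *)
Lemma integral_monomial_pdf_step s k : s != 0 ->
  (\int[mu]_(x in `[0%R, +oo[) (monomial_pdf s k.+2 x)%:E =
   (k.+1%:R * s ^+ 2)%:E * \int[mu]_(x in `[0%R, +oo[) (monomial_pdf s k x)%:E)%E.
Proof.
move=> s0.
set c := _ * s ^+ 2.
have c0 : 0 < c by rewrite mulr_gt0// exprn_even_gt0.
pose a := Num.sqrt c.
have a0 : 0 < a by rewrite sqrtr_gt0.
pose G := monomial_pdf s k.+2; pose H x := c * monomial_pdf s k x.
pose F x := - s ^+ 2 * monomial_pdf s k.+1 x.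
have GHE x : G x - H x = (x ^+ 2 - c) * monomial_pdf s k x.
  by rewrite /G /H /monomial_pdf !exprS; ring.
have cG : continuous G by exact: continuous_monomial_pdf.
have cH : continuous H.
  by move=> x; apply: cvgM; [exact: cvg_cst|exact: continuous_monomial_pdf].
have cF : continuous F.
  by move=> x; apply: cvgM; [exact: cvg_cst|exact: continuous_monomial_pdf].
have cGH : continuous (G - H) by move=> x; apply: cvgB; [exact: cG|exact: cH].
have dF x : is_derive x 1 F ((G - H) x) by exact: is_derive_monomial_pdf.
have mono0 j x : 0 <= x -> 0 <= monomial_pdf s j x.
  by move=> x0; rewrite mulr_ge0 ?exprn_ge0// normal_pdf_ge0.
have G0 x : 0 <= x -> 0 <= G x by exact: mono0.
have H0 x : 0 <= x -> 0 <= H x by move=> x0; rewrite mulr_ge0 ?mono0// ltW.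
have GH0 x : a <= x -> 0 <= (G - H) x.
  move=> ax; have x0 : 0 <= x by exact: le_trans (ltW a0) ax.
  rewrite -[leRHS]/(G x - H x) GHE mulr_ge0 ?mono0// subr_ge0.
  by rewrite -(sqr_sqrtr (ltW c0)) ler_sqr ?nnegrE// ltW.
have HG0 x : 0 <= x <= a -> 0 <= (H - G) x.
  move=> /andP[x0 xa].
  rewrite -[leRHS]/(H x - G x) -opprB GHE -mulNr mulr_ge0 ?mono0// opprB subr_ge0.
  by rewrite -(sqr_sqrtr (ltW c0)) ler_sqr ?nnegrE// ltW.
have FTCr : (\int[mu]_(x in `[a, +oo[) ((G - H) x)%:E = - (F a)%:E)%E.
  rewrite (@ge0_continuous_FTC2y _ _ F _ 0) ?add0e//.
  - exact: continuous_subspaceT.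
  - rewrite -[X in _ --> X](mulr0 (- s ^+ 2)).
    by apply: cvgM; [exact: cvg_cst|exact: cvg_monomial_pdf].
  - exact: cvg_at_right_filter (cF a).
  - by move=> x _; rewrite derive1E; exact: derive_val.
have FTCl : (\int[mu]_(x in `[0%R, a]) ((H - G) x)%:E = - (F a)%:E)%E.
  have F00 : F 0 = 0 by rewrite /F /monomial_pdf expr0n mul0r mulr0.
  have dNF x : is_derive x 1 (- F) ((H - G) x).
    by rewrite -[H - G]opprB; exact: is_deriveN.
  rewrite (@continuous_FTC2 _ _ (- F) _ _)//.
  - by rewrite !fctE F00 oppr0 sube0.
  - by apply: continuous_subspaceT => x; apply: cvgB; [exact: cH|exact: cG].
  - split => [//| |].
    + by apply: cvg_at_right_filter; apply: cvgN; exact: cF.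
    + by apply: cvg_at_left_filter; apply: cvgN; exact: cF.
  - by move=> x _; rewrite derive1E; exact: derive_val.
have mH D : measurable D -> measurable_fun D (EFin \o H : R -> \bar R).
  move=> mD; apply: measurable_funTS; apply/measurable_EFinP.
  exact: continuous_measurable_fun.
rewrite -ge0_integralZl//=.
- rewrite -[RHS]/(\int[mu]_(x in `[0%R, +oo[) (H x)%:E)%E.
  rewrite (ge0_integral_itv_cat (ltW a0))//.
  rewrite [RHS](ge0_integral_itv_cat (ltW a0))//.
  rewrite (@ge0_integral_subK [set` `[a, +oo[] G H)//; last 2 first.
  + by move=> x; rewrite /= in_itv/= andbT; exact: GH0.
  + move=> x; rewrite /= in_itv/= andbT => ax; apply: H0.
    exact: le_trans (ltW a0) ax.
  rewrite FTCr -FTCl addeA; congr (_ + _)%E.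
  rewrite addeC -ge0_integral_subK//.
  by move=> x; rewrite /= in_itv/= => /andP[x0 _]; exact: G0.
- apply: measurable_funTS; apply/measurable_EFinP.
  by apply: continuous_measurable_fun; exact: continuous_monomial_pdf.
- by move=> x; rewrite /= in_itv/= andbT => x0; rewrite lee_fin mono0.
- by rewrite lee_fin ltW.
Qed.

Lemma integral_even_monomial_pdf s k : s != 0 -> ~~ odd k ->
  (\int[mu]_x (monomial_pdf s k.+2 x)%:E =
   (k.+1%:R * s ^+ 2)%:E * \int[mu]_x (monomial_pdf s k x)%:E)%E.
Proof.
move=> s0 ek.
have sym j : ~~ odd j -> (\int[mu]_x (monomial_pdf s j x)%:E =
    2%:E * \int[mu]_(x in `[0%R, +oo[) (monomial_pdf s j x)%:E)%E.
  move=> ej; rewrite ge0_symfun_integralT ?set_itvcy//.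
  - by move=> x; rewrite mulr_ge0 ?normal_pdf_ge0// exprn_even_ge0.
  - exact: continuous_monomial_pdf.
  - move=> x; rewrite /monomial_pdf/= !normal_pdfE// /normal_fun !subr0 sqrrN.
    by rewrite exprNn -signr_odd (negbTE ej) expr0 mul1r.
by rewrite !sym//= ?negbK// integral_monomial_pdf_step// muleCA.
Qed.

Lemma integral_normal_prob_sqr s : s != 0 ->
  (\int[normal_prob 0 s]_x (x ^+ 2)%:E = (s ^+ 2)%:E)%E.
Proof.
move=> s0; rewrite ge0_integral_normal_prob.
- under eq_integral do rewrite -EFinM.
  rewrite (integral_even_monomial_pdf s0 (isT : ~~ odd 0)) mul1r.
  under eq_integral do rewrite /monomial_pdf mul1r.
  by rewrite integral_normal_pdf mule1.
- by apply/measurable_EFinP; exact: measurable_funX.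
- by move=> x; rewrite lee_fin sqr_ge0.
Qed.

Lemma integral_normal_prob_expr4 s : s != 0 ->
  (\int[normal_prob 0 s]_x (x ^+ 4)%:E = (3 * s ^+ 4)%:E)%E.
Proof.
move=> s0; rewrite ge0_integral_normal_prob.
- under eq_integral do rewrite -EFinM.
  rewrite (integral_even_monomial_pdf s0 (isT : ~~ odd 2)).
  rewrite (integral_even_monomial_pdf s0 (isT : ~~ odd 0)) mul1r.
  under eq_integral do rewrite /monomial_pdf mul1r.
  by rewrite integral_normal_pdf mule1 -EFinM -mulrA -exprD.
- by apply/measurable_EFinP; exact: measurable_funX.
- by move=> x; rewrite lee_fin exprn_even_ge0.
Qed.

End NormalMoments.

(** * Independence and uncorrelatedness *)

Section Independence.
Local Open Scope ereal_scope.
Context d (T : measurableType d) (R : realType) (P : probability T R).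

(** The product rule on rectangles says that the joint law is the product of
    the marginals; nonnegativity lets Tonelli apply with no integrability
    assumption. *)
Lemma expectation_mul_independent (X Y : {RV P >-> R}) :
  (forall w, 0 <= X w)%R -> (forall w, 0 <= Y w)%R ->
  (forall A B, measurable A -> measurable B ->
    P (X @^-1` A `&` Y @^-1` B) = P (X @^-1` A) * P (Y @^-1` B)) ->
  'E_P[X \* Y] = 'E_P[X] * 'E_P[Y].
Proof.
move=> X0 Y0 indep; rewrite unlock.
pose Z w := (X w, Y w).
have mZ : measurable_fun setT Z by exact: measurable_fun_pair.
pose Zfun := isMeasurableFun.Build _ _ _ _ Z mZ.
pose XY : {mfun T >-> (R * R)%type} := HB.pack Z Zfun.
(* The absolute values make g nonnegative on the whole plane, and not only on
   the range of (X, Y). *)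
pose g (z : R * R) : \bar R := (`|z.1| * `|z.2|)%:E.
have mg : measurable_fun setT g.
  apply/measurable_EFinP; apply: measurable_funM.
  - by apply: measurableT_comp => //; exact: measurable_fst.
  - by apply: measurableT_comp => //; exact: measurable_snd.
have mnorm : measurable_fun setT (fun x : R => `|x|%:E).
  by apply: measurableT_comp => //; exact: measurableT_comp.
have g0 z : 0 <= g z by rewrite lee_fin mulr_ge0.
transitivity (\int[P]_w (g \o XY) w).
  by apply: eq_integral => w _; rewrite /g/= !ger0_norm.
rewrite -ge0_integral_distribution//.
rewrite (@eq_measure_integral _ _ _ setT
  (distribution P X \x distribution P Y)); last first.
  move=> A mA _; apply/esym; apply: product_measure_unique; last by [].
  exact: indep.
rewrite fubini_tonelli1// /fubini_F.
under eq_integral => x _.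
  under eq_integral => y _ do rewrite /g/= EFinM.
  rewrite ge0_integralZl//.
  over.
rewrite ge0_integralZr//; last first.
  by apply: integral_ge0 => y _; rewrite lee_fin.
rewrite !ge0_integral_distribution//.
by congr (_ * _); apply: eq_integral => w _ /=; rewrite ger0_norm.
Qed.

Lemma sqr_integrable_Lfun2 (f : T -> R) : measurable_fun setT f ->
  \int[P]_w (f w ^+ 2)%:E < +oo -> f \in Lfun P 2%:E.
Proof.
move=> mf foo; rewrite inE; apply/andP; split; rewrite inE//=.
rewrite /finite_norm unlock poweR_lty//.
under eq_integral => x _ do
  rewrite /= (@powR_mulrn _ _ 2) ?normr_ge0// real_normK ?num_real//.
by [].
Qed.

Lemma variance_sum_uncorrelated (I : eqType) (s : seq I) (X : I -> T -> R) :
  uniq s -> (forall i, i \in s -> X i \in Lfun P 2%:E) ->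
  {in s &, forall i j, i != j -> covariance P (X i) (X j) = 0} ->
  'V_P[(\sum_(i <- s) X i)%R] = \sum_(i <- s) 'V_P[X i].
Proof.
elim: s => [|a s IH] /=; first by rewrite !big_nil variance_cst.
move=> /andP[ans us] L2 cov0.
have L2a : X a \in Lfun P 2%:E by rewrite L2 ?mem_head.
have L2s i : i \in s -> X i \in Lfun P 2%:E.
  by move=> si; rewrite L2// inE si orbT.
have covS (t : seq I) : {subset t <= s} ->
    covariance P (X a) (\sum_(i <- t) X i)%R = 0.
  elim: t => [|b t IHt] ts; first by rewrite big_nil covariance_cst_r.
  have bs : b \in s by rewrite ts ?mem_head.
  have ts' : {subset t <= s} by move=> i ti; rewrite ts// inE ti orbT.
  rewrite big_cons covarianceDr//; last 2 first.
  - exact: L2s.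
  - by rewrite big_seq rpred_sum ?lee1n// => ? i ti; apply: L2s; exact: ts'.
  rewrite IHt// adde0 cov0 ?mem_head// ?inE ?bs ?orbT//.
  by apply: contra ans => /eqP ->.
rewrite !big_cons varianceD//; last first.
  by rewrite big_seq rpred_sum ?lee1n// => ? i si; exact: L2s.
rewrite covS// mule0 adde0 IH//.
by move=> i j si sj; apply: cov0; rewrite inE ?si ?sj orbT.
Qed.

Lemma expectation_sum_fun (I : eqType) (s : seq I) (X : I -> T -> R) :
  (forall i, i \in s -> X i \in Lfun P 1) ->
  'E_P[(\sum_(i <- s) X i)%R] = \sum_(i <- s) 'E_P[X i].
Proof.
move=> L1; rewrite -(big_map X xpredT id) expectation_sum ?big_map//.
by move=> _ /mapP[i si ->]; exact: L1.
Qed.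

End Independence.

(** * Concentration of a sum of squares of normal variables *)

Section SumOfSquares.
Local Open Scope ereal_scope.
Context d (T : measurableType d) (R : realType) (P : probability T R).
Context (n : nat) (xi : 'I_n -> {RV P >-> R}) (sigma : R).
Hypothesis sigma_neq0 : (sigma != 0)%R.
Hypothesis iid : iid_centered_normal xi sigma.

Let sq i (w : T) : R := (xi i w ^+ 2)%R.

Let msq i : measurable_fun setT (sq i).
Proof. exact: measurable_funX. Qed.

Let expectation_normal i (f : R -> R) : measurable_fun setT f ->
  (forall x, 0 <= f x)%R ->
  \int[P]_w (f (xi i w))%:E = \int[normal_prob 0 sigma]_x (f x)%:E.
Proof.
move=> mf f0.
(* The normal law is a measure on the Borel structure generated by intervals:
   the same sigma-algebra as that of R, under another name. *)
pose X : T -> measurableTypeR R := xi i.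
have mX : measurable_fun setT X by exact: (measurable_funPT (xi i)).
pose Xfun : {mfun T >-> measurableTypeR R} :=
  HB.pack X (isMeasurableFun.Build _ _ _ _ X mX).
rewrite -[LHS]/(\int[P]_w ((EFin \o f) \o Xfun) w).
rewrite -(@ge0_integral_distribution _ _ _ (measurableTypeR R) _ _ Xfun)//.
- by apply: eq_measure_integral => A mA _; exact: iid.2.
- by apply/measurable_EFinP; exact: mf.
Qed.

Let sqE i : 'E_P[sq i] = (sigma ^+ 2)%:E.
Proof.
rewrite unlock -(integral_normal_prob_sqr sigma_neq0).
rewrite (@expectation_normal i (fun x => x ^+ 2)%R)//.
by move=> x; exact: sqr_ge0.
Qed.

Let sq2E i : \int[P]_w (sq i w ^+ 2)%:E = (3 * sigma ^+ 4)%:E.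
Proof.
rewrite -(integral_normal_prob_expr4 sigma_neq0).
under eq_integral do rewrite /sq -exprM.
rewrite (@expectation_normal i (fun x => x ^+ 4)%R)//.
by move=> x; rewrite exprn_even_ge0.
Qed.

Let sqL2 i : sq i \in Lfun P 2%:E.
Proof. by apply: sqr_integrable_Lfun2; rewrite ?sq2E ?ltry. Qed.

Let sqL1 i : sq i \in Lfun P 1.
Proof. by apply: Lfun_subset12 (sqL2 i); rewrite fin_num_measure. Qed.

Let sqV i : 'V_P[sq i] = (2 * sigma ^+ 4)%:E.
Proof.
rewrite varianceE// sqE.
have -> : 'E_P[sq i ^+ 2] = (3 * sigma ^+ 4)%:E by rewrite -(sq2E i) unlock.
by rewrite expe2 -EFinM -EFinB; congr EFin; ring.
Qed.

Let sq_uncorrelated i j : i != j -> covariance P (sq i) (sq j) = 0.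
Proof.
move=> ij; rewrite covarianceE//; last exact: Lfun2_mul_Lfun1.
pose sqRV k : {RV P >-> R} :=
  HB.pack (sq k) (isMeasurableFun.Build _ _ _ _ _ (msq k)).
rewrite [X in X - _](expectation_mul_independent (X := sqRV i) (Y := sqRV j)).
- by rewrite !sqE -EFinM subee.
- by move=> w; exact: sqr_ge0.
- by move=> w; exact: sqr_ge0.
move=> A B mA mB.
have mX (C : set R) : measurable C -> measurable ((fun x : R => x ^+ 2)%R @^-1` C).
  by move=> mC; rewrite -[X in measurable X]setTI; exact: measurable_funX.
pose C k := if k == i then (fun x : R => x ^+ 2)%R @^-1` A
            else (fun x : R => x ^+ 2)%R @^-1` B.
have := iid.1 [set i; j]%SET C.
rewrite big_setU1 ?inE//= big_set1 /C eqxx eq_sym (negbTE ij) => <-.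
- congr (P _); apply/seteqP; split => [w [Aw Bw] k|w].
  + by rewrite /= !inE => /orP[/eqP->|/eqP->]; rewrite ?eqxx// eq_sym (negbTE ij).
  + move=> H; split.
    * by have := H i; rewrite /= !inE !eqxx => /(_ isT).
    * by have := H j; rewrite /= !inE !eqxx orbT eq_sym (negbTE ij) => /(_ isT).
- by move=> k _; case: ifP => _; exact: mX.
Qed.

(** Chebyshev's inequality with deviation [q / 2]: the variance is
    [2 #|J| sigma ^ 4], so the exceptional event has probability at most
    [4 (2 #|J| sigma ^ 4) / q ^ 2]. *)
Lemma sum_sqr_normal_concentration (J : {set 'I_n}) :
  let Q w := (\sum_(i in J) xi i w ^+ 2)%R in
  let q := (#|J|%:R * sigma ^+ 2)%R in
  (0 < #|J|)%N ->
  measurable [set w | `|Q w - q| < q / 2]%R /\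
  (1 - 8 / #|J|%:R)%:E <= P [set w | `|Q w - q| < q / 2]%R.
Proof.
move=> Q q J0.
pose S : T -> R := (\sum_(i <- enum J) sq i)%R.
have SE : S = Q.
  by apply/funext => w; rewrite /S fct_sumE /Q big_enum.
have mQ : measurable_fun setT Q.
  have -> : Q = (fun w => \sum_(i <- enum J) sq i w)%R.
    by apply/funext => w; rewrite big_enum.
  by apply: measurable_sum => i; exact: msq.
have EQ : 'E_P[Q] = q%:E.
  rewrite -SE expectation_sum_fun//.
  rewrite (eq_bigr (fun=> (sigma ^+ 2)%:E))// big_enum/= sumEFin sumr_const.
  by rewrite -mulr_natl.
have VQ : 'V_P[Q] = (#|J|%:R * (2 * sigma ^+ 4))%:E.
  rewrite -SE variance_sum_uncorrelated ?enum_uniq//; last first.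
    by move=> i j _ _; exact: sq_uncorrelated.
  rewrite (eq_bigr (fun=> (2 * sigma ^+ 4)%:E))// big_enum/= sumEFin sumr_const.
  by rewrite [in RHS]mulr_natl.
have q0 : (0 < q)%R by rewrite mulr_gt0 ?ltr0n// exprn_even_gt0.
pose QRV : {RV P >-> R} := HB.pack Q (isMeasurableFun.Build _ _ _ _ _ mQ).
have q20 : (0 < q / 2)%R by rewrite divr_gt0.
have := chebyshev QRV q20.
rewrite EQ VQ/= -EFinM => Pbad.
have mbad : measurable [set w | q / 2 <= `|Q w - q|]%R.
  have mdev : measurable_fun setT (fun w => `|Q w - q|)%R.
    by apply: measurableT_comp => //; exact: measurable_funB.
  rewrite (_ : [set w | _] = (fun w => `|Q w - q|)%R @^-1` [set x | q / 2 <= x]%R)//.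
  by rewrite -set_itvcy -[X in measurable X]setTI; exact: mdev.
have -> : [set w | `|Q w - q| < q / 2]%R = ~` [set w | q / 2 <= `|Q w - q|]%R.
  by apply/seteqP; split=> w /=; rewrite ltNge => /negP.
split; first exact: measurableC.
rewrite probability_setC// EFinB leeB//.
apply: le_trans Pbad _; rewrite lee_fin /q le_eqVlt; apply/orP; left; apply/eqP.
have J0' : (#|J|%:R != 0 :> R)%R by rewrite pnatr_eq0 -lt0n.
by field; rewrite sigma_neq0 J0'.
Qed.

End SumOfSquares.

(** * Measurability of sets that are open in finitely many coordinates *)

(** Boxes with rational endpoints form a countable base, so such a set is the
    countable union of the boxes that it contains. *)
Lemma measurable_of_open_coordinates d (T : measurableType d) (R : realType)
    (n : nat) (h : 'I_n -> T -> R) (S : set T) :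
  (forall i, measurable_fun setT (h i)) ->
  (forall w, S w -> exists2 e : R, 0 < e &
     forall w', (forall i, `|h i w' - h i w| < e) -> S w') ->
  measurable S.
Proof.
move=> mh openS.
pose box (b : {ffun 'I_n -> rat * rat}) : set T :=
  \bigcap_(i in [set: 'I_n]) h i @^-1` `]ratr (b i).1, ratr (b i).2[.
have mbox b : measurable (box b).
  apply: fin_bigcap_measurable => // i _.
  by rewrite -[X in measurable X]setTI; exact: mh.
have -> : S = \bigcup_b if `[< box b `<=` S >] then box b else set0.
  apply/seteqP; split => [w Sw|w [b _]]; last by case: asboolP => // /[apply].
  have [e e0 eS] := openS _ Sw.
  have near_rat i : {b : rat * rat |
      h i w - e < ratr b.1 < h i w /\ h i w < ratr b.2 < h i w + e}.
    apply: cid.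
    have /rat_in_itvoo[p] : h i w - e < h i w by rewrite ltrBlDr ltrDl.
    have /rat_in_itvoo[q] : h i w < h i w + e by rewrite ltrDl.
    by rewrite !in_itv/= => hq hp; exists (p, q).
  pose b := [ffun i => sval (near_rat i)].
  have bP i : h i w - e < ratr (b i).1 < h i w /\ h i w < ratr (b i).2 < h i w + e.
    by rewrite ffunE; exact: (svalP (near_rat i)).
  exists b => //; rewrite asboolT => [i _|w' bw'].
    by have [/andP[_ ?] /andP[? _]] := bP i; rewrite /= in_itv/=; apply/andP.
  apply: eS => i; have [/andP[? _] /andP[_ ?]] := bP i.
  by have := bw' i I; rewrite /= in_itv/= => /andP[? ?]; rewrite ltr_distl; lra.
apply: countable_bigcupT_measurable => // b.
by case: ifP => // _.
Qed.

(** * Projection onto the set of aggregates *)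

Section Projection.
Context (R : realType) (n M : nat) (X : Type) (x : 'I_n -> X) (f : 'I_M -> X -> R).
Hypothesis n_gt0 : (0 < n)%N.
Implicit Types (Y : 'I_n -> R) (l u : 'rV[R]_M).

Local Notation fit l i := (aggregate f l (x i)).
Local Notation minimizer Y l :=
  (argmin (@simplex R M) (fun v => empirical_MSE x Y (aggregate f v)) l).

Lemma simplex_segment l u (t : R) : 0 <= t <= 1 ->
  simplex l -> simplex u -> simplex (l + t *: (u - l)).
Proof.
move=> /andP[t0 t1] [l0 l1] [u0 u1]; split.
  move=> j; rewrite !mxE.
  have -> : l ord0 j + t * (u ord0 j - l ord0 j) =
    (1 - t) * l ord0 j + t * u ord0 j by ring.
  by rewrite addr_ge0 ?mulr_ge0// subr_ge0.
under eq_bigr do rewrite !mxE.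
by rewrite big_split/= -mulr_sumr sumrB l1 u1; ring.
Qed.

Lemma fit_segment l u (t : R) i :
  fit (l + t *: (u - l)) i = fit l i + t * (fit u i - fit l i).
Proof.
rewrite /aggregate; under eq_bigr do rewrite !mxE.
rewrite -sumrB mulr_sumr -big_split/=.
by apply: eq_bigr => j _; ring.
Qed.

Lemma minimizer_residual_le Y l u : minimizer Y l -> simplex u ->
  \sum_i (Y i - fit l i) ^+ 2 <= \sum_i (Y i - fit u i) ^+ 2.
Proof.
move=> [_ lmin] /lmin; rewrite /empirical_MSE ler_pM2l//.
by rewrite invr_gt0 ltr0n.
Qed.

(** First-order optimality: otherwise moving slightly from [l] towards [u]
    would decrease the residual. *)
Lemma minimizer_variational Y l u : minimizer Y l -> simplex u ->
  \sum_i (Y i - fit l i) * (fit u i - fit l i) <= 0.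
Proof.
move=> lmin su; have sl : simplex l by case: lmin.
set D := (X in X <= 0); pose N := \sum_i (fit u i - fit l i) ^+ 2.
have N0 : 0 <= N by apply: sumr_ge0 => i _; exact: sqr_ge0.
rewrite leNgt; apply/negP => D0.
(* Along the segment the residual changes by t (t N - 2 D), and t N < D. *)
pose t := D / (D + N).
have DN0 : 0 < D + N by exact: ltr_wpDr.
have t0 : 0 < t by rewrite divr_gt0.
have t1 : t <= 1 by rewrite ler_pdivrMr// mul1r lerDl.
have := minimizer_residual_le lmin (simplex_segment _ sl su).
move=> /(_ t); rewrite (ltW t0) t1 => /(_ isT).
have -> : \sum_i (Y i - fit (l + t *: (u - l)) i) ^+ 2 =
    \sum_i (Y i - fit l i) ^+ 2 - 2 * t * D + t ^+ 2 * N.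
  rewrite /D /N !mulr_sumr -sumrB -big_split/=.
  by apply: eq_bigr => i _; rewrite fit_segment; ring.
apply/negP; rewrite -ltNge -addrA gtrDl.
have -> : - (2 * t * D) + t ^+ 2 * N = - t * (2 * D - t * N) by ring.
rewrite mulNr oppr_lt0 mulr_gt0// subr_gt0.
rewrite /t mulrAC ltr_pdivrMr//; nra.
Qed.

(** The optimality conditions of the two projections, tested against each other
    and added up.  In particular the fitted values do not depend on which
    minimizer is selected. *)
Lemma projection_contraction Y Y' l l' : minimizer Y l -> minimizer Y' l' ->
  \sum_i (fit l' i - fit l i) ^+ 2 <= \sum_i (Y' i - Y i) ^+ 2.
Proof.
move=> lmin lmin'; have [[sl _] [sl' _]] := (lmin, lmin').
have v := minimizer_variational lmin sl'.
have v' := minimizer_variational lmin' sl.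
rewrite -subr_ge0.
have -> : \sum_i (Y' i - Y i) ^+ 2 - \sum_i (fit l' i - fit l i) ^+ 2 =
  \sum_i (Y' i - Y i - (fit l' i - fit l i)) ^+ 2 +
  - 2 * (\sum_i (Y i - fit l i) * (fit l' i - fit l i) +
     \sum_i (Y' i - fit l' i) * (fit l i - fit l' i)).
  rewrite -sumrB -big_split mulr_sumr -big_split/=.
  by apply: eq_bigr => i _; ring.
rewrite addr_ge0//; first by apply: sumr_ge0 => i _; exact: sqr_ge0.
by rewrite mulNr oppr_ge0 pmulr_rle0//; lra.
Qed.

End Projection.

(** * Aggregates of the dictionary form a cross-polytope *)

Lemma max_opp_norm (R : realDomainType) (z : R) : Num.max z 0 + Num.max (- z) 0 = `|z|.
Proof.
have [z0|z0] := leP 0 z.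
  by rewrite max_r ?oppr_le0// ger0_norm// addr0.
by rewrite max_l ?oppr_ge0 ?(ltW z0)// ltr0_norm// add0r.
Qed.

Lemma max_opp_sub (R : realDomainType) (z : R) : Num.max z 0 - Num.max (- z) 0 = z.
Proof.
have [z0|z0] := leP 0 z.
  by rewrite max_r ?oppr_le0// subr0.
by rewrite max_l ?oppr_ge0 ?(ltW z0)// sub0r opprK.
Qed.

Section CrossPolytope.
Context (R : realType) (n m M : nat) (sigma : R).
Hypotheses (n_gt0 : (0 < n)%N) (m_gt0 : (0 < m)%N) (mM : (2 * m < M)%N).
Hypothesis sigma_gt0 : 0 < sigma.

Let a : R := sigma * Num.sqrt n%:R.

Let a_gt0 : 0 < a. Proof. by rewrite mulr_gt0// sqrtr_gt0 ltr0n. Qed.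

(** The positive parts of the coordinates of [y] are carried by the vertices
    [a e^(j)], the negative parts by the opposite vertices, and the mass that
    remains by the zero vector, which has index [2 m] when counting from 0. *)
Definition cross_polytope_weight (y : nat -> R) (j : nat) : R :=
  if (j < m)%N then Num.max (y j) 0 / a
  else if (j < 2 * m)%N then Num.max (- y (j - m)%N) 0 / a
  else if j == (2 * m)%N then 1 - (\sum_(0 <= k < m) `|y k|) / a
  else 0.

Let w := cross_polytope_weight.

(** Taking [phi] constant gives the total mass, and taking for [phi] a coordinate
    of the dictionary gives that coordinate of the aggregate. *)
Lemma sum_cross_polytope_weight y (phi : nat -> R) :
  \sum_(j < M) w y j * phi j =
  (\sum_(0 <= k < m)
     (Num.max (y k) 0 * phi k + Num.max (- y k) 0 * phi (m + k)%N)) / a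
  + (1 - (\sum_(0 <= k < m) `|y k|) / a) * phi (2 * m)%N.
Proof.
have w1 k : (k < m)%N -> w y k = Num.max (y k) 0 / a.
  by move=> km; rewrite /w /cross_polytope_weight km.
have w2 k : (k < m)%N -> w y (m + k)%N = Num.max (- y k) 0 / a.
  move=> km; rewrite /w /cross_polytope_weight ltnNge leq_addr/= addnC addnK.
  by rewrite ifT//; lia.
have w3 : w y (2 * m)%N = 1 - (\sum_(0 <= k < m) `|y k|) / a.
  by rewrite /w /cross_polytope_weight ltnn eqxx ifF//; lia.
have w4 k : (2 * m < k)%N -> w y k = 0.
  by move=> mk; rewrite /w /cross_polytope_weight !ifF//; lia.
rewrite -(big_mkord xpredT (fun j => w y j * phi j)).
rewrite (@big_cat_nat _ _ _ (2 * m)%N)//=; last exact: ltnW.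
rewrite [X in _ + X]big_ltn//.
rewrite [X in _ + (_ + X)]big_nat_cond [X in _ + (_ + X)]big1 => [|k]; last first.
  by rewrite andbT => /andP[mk _]; rewrite w4// mul0r.
rewrite addr0 w3; congr (_ + _).
rewrite (@big_cat_nat _ _ _ m)//=; last by lia.
rewrite -{2}[m]add0n big_addn mul2n -addnn addnK.
rewrite -big_split/= mulr_suml; apply: eq_big_nat => k /andP[_ km].
by rewrite addnC w1// w2//; ring.
Qed.

Lemma simplex_cross_polytope_weight y : \sum_(0 <= k < m) `|y k| <= a ->
  simplex (\row_(j < M) w y j).
Proof.
move=> ya; split => [j|].
  rewrite mxE /w /cross_polytope_weight; case: ifP => _.
    by rewrite divr_ge0 ?(ltW a_gt0)// le_max lexx orbT.
  case: ifP => _; first by rewrite divr_ge0 ?(ltW a_gt0)// le_max lexx orbT.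
  by case: ifP => // _; rewrite subr_ge0 ler_pdivrMr// mul1r.
under eq_bigr do rewrite mxE -[w y _]mulr1.
rewrite (sum_cross_polytope_weight y (fun=> 1)) mulr1.
under eq_bigr do rewrite !mulr1 max_opp_norm.
by rewrite addrC subrK.
Qed.

Lemma aggregate_cross_polytope_weight (X : Type) (x : 'I_n -> X)
    (f : 'I_M -> X -> R) y (i : 'I_n) :
  is_dictionary m sigma x f ->
  aggregate f (\row_(j < M) w y j) (x i) = if (i < m)%N then y i else 0.
Proof.
move=> dict; rewrite /aggregate.
under eq_bigr do rewrite mxE dict.
rewrite (sum_cross_polytope_weight y
  (fun j => dictionary_vector n m sigma j ord0 i)).
have d1 k : (k < m)%N ->
    dictionary_vector n m sigma k ord0 i = a * ((i : nat) == k)%:R.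
  by move=> km; rewrite /dictionary_vector km !mxE.
have d2 k : (k < m)%N ->
    dictionary_vector n m sigma (m + k) ord0 i = - (a * ((i : nat) == k)%:R).
  move=> km; rewrite /dictionary_vector ltnNge leq_addr/= ifT; last by lia.
  by rewrite !mxE addnC addnK mulNr.
have -> : dictionary_vector n m sigma (2 * m) ord0 i = 0.
  by rewrite /dictionary_vector ltnn eqxx ifF ?mxE//; lia.
rewrite mulr0 addr0 mulr_suml.
rewrite (@eq_big_nat _ _ _ _ _ _ (fun k => y k * ((i : nat) == k)%:R)); last first.
  move=> k /andP[_ km]; rewrite d1// d2//.
  rewrite -[X in _ = X * _]max_opp_sub; field.
  by rewrite gt_eqF.
rewrite big_mkord; case: ifP => im.
  rewrite (bigD1 (Ordinal im))//= eqxx mulr1 big1 ?addr0// => k ki.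
  rewrite [_ == _](_ : _ = false) ?mulr0//.
  by apply: contraNF ki => /eqP ik; apply/eqP/val_inj.
apply: big1 => k _; rewrite [_ == _](_ : _ = false) ?mulr0//.
by apply/negbTE/eqP => ik; rewrite ik ltn_ord in im.
Qed.

End CrossPolytope.

(** * The lower bound event *)

(** Young's inequality [(v + h) ^ 2 <= (1 + t) v ^ 2 + (1 + 1 / t) h ^ 2], with [t] so
    small that [t] times the sum of the [v i ^ 2] uses up less than half of the
    gap to [b]. *)
Lemma sum_sqr_lt_open (R : realType) (n : nat) (v : 'I_n -> R) (b : R) :
  \sum_i v i ^+ 2 < b ->
  exists2 r : R, 0 < r & forall v' : 'I_n -> R,
    \sum_i (v' i - v i) ^+ 2 <= r -> \sum_i v' i ^+ 2 < b.
Proof.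
set S := \sum_(i < n) v i ^+ 2 => Sb.
have S0 : 0 <= S by apply: sumr_ge0 => i _; exact: sqr_ge0.
pose g := b - S; have g0 : 0 < g by rewrite subr_gt0.
pose t := g / (2 * (S + 1)).
have S1 : 0 < 2 * (S + 1) by rewrite mulr_gt0// ltr_wpDl.
have t0 : 0 < t by rewrite divr_gt0.
have c0 : 0 < 1 + t^-1 by rewrite addr_gt0// invr_gt0.
exists (g / 2 / (1 + t^-1)); first by rewrite !divr_gt0.
move=> v'; rewrite ler_pdivlMr// => v'v.
have tS : t * S < g / 2.
  have -> : g / 2 = t * (S + 1) by rewrite /t; field; rewrite gt_eqF// ltr_wpDl.
  by rewrite ltr_pM2l// ltrDl.
suff : \sum_i v' i ^+ 2 <= (1 + t) * S + (\sum_i (v' i - v i) ^+ 2) * (1 + t^-1).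
  by move=> /le_lt_trans; apply; rewrite /g in v'v tS *; lra.
rewrite /S mulr_sumr mulr_suml -big_split/=; apply: ler_sum => i _.
rewrite -subr_ge0.
have -> : (1 + t) * v i ^+ 2 + (v' i - v i) ^+ 2 * (1 + t^-1) - v' i ^+ 2 =
  t^-1 * (t * v i - (v' i - v i)) ^+ 2.
  by field; rewrite gt_eqF.
by rewrite mulr_ge0 ?sqr_ge0// invr_ge0 ltW.
Qed.

Section Event.
Context (R : realType) (n m M : nat) (sigma : R) (X : Type) (x : 'I_n -> X).
Context (f : 'I_M -> X -> R) (eta : X -> R).
Hypotheses (n_gt0 : (0 < n)%N) (m_gt0 : (0 < m)%N) (mn : (m <= n)%N).
Hypotheses (mM : (2 * m < M)%N) (sigma_gt0 : 0 < sigma).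
Hypothesis dict : is_dictionary m sigma x f.
Hypothesis eta0 : forall z, eta z = 0.

Local Notation minimizer Y l :=
  (argmin (@simplex R M) (fun v => empirical_MSE x Y (aggregate f v)) l).

Lemma MSE_noise_free (g : X -> R) : MSE x eta g = n%:R^-1 * \sum_i g (x i) ^+ 2.
Proof.
by rewrite /MSE; congr (_ * _); apply: eq_bigr => i _; rewrite eta0 sub0r sqrrN.
Qed.

Lemma min_MSE_dictionary : min_MSE x eta f = 0%E.
Proof.
apply/le_anti/andP; split.
  have M0 : MSE x eta (f (Ordinal mM)) = 0.
    rewrite MSE_noise_free big1 ?mulr0// => i _; rewrite dict /dictionary_vector /=.
    by rewrite ltnn eqxx ifF ?mxE ?expr0n//; lia.
  rewrite -[leRHS]/(0%:E) -M0 /min_MSE.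
  exact: (@bigmin_le_cond _ _ _ +oo%E (Ordinal mM) xpredT
    (fun j => (MSE x eta (f j))%:E)).
apply: le_bigmin; first exact: leey.
move=> j _; rewrite lee_fin MSE_noise_free mulr_ge0 ?invr_ge0 ?ler0n//.
by apply: sumr_ge0 => i _; exact: sqr_ge0.
Qed.

Lemma aggregate_out_of_span (l : 'rV[R]_M) (i : 'I_n) : (m <= i)%N ->
  aggregate f l (x i) = 0.
Proof.
move=> mi; apply: big1 => j _; rewrite dict /dictionary_vector.
have im k : (k < m)%N -> ((i : nat) == k) = false by move=> km; apply/eqP; lia.
case: ifP => [jm|jm]; first by rewrite !mxE im// !mulr0.
case: ifP => [j2m|j2m]; first by rewrite !mxE im ?mulr0//; lia.
by case: ifP => _; rewrite !mxE ?mulr0// im// !mulr0.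
Qed.

(** When the first m observations lie in the cross-polytope, some aggregate
    reproduces them; as no aggregate can fit the other observations better
    than 0 does, a minimizer must reproduce them too. *)
Lemma aggregate_exact (Y : 'I_n -> R) (l : 'rV[R]_M) (i : 'I_n) :
  minimizer Y l -> \sum_(i < n | (i < m)%N) `|Y i| <= sigma * Num.sqrt n%:R ->
  (i < m)%N -> aggregate f l (x i) = Y i.
Proof.
move=> lmin Ya im.
(* The default value 0 is never used: k < m <= n below. *)
pose y k := oapp Y 0 (insub k).
have yE (k : 'I_n) : y k = Y k by rewrite /y valK.
have sy : simplex (\row_(j < M) cross_polytope_weight n m sigma y j).
  apply: simplex_cross_polytope_weight => //.
  rewrite big_mkord (big_ord_widen n (fun k => `|y k|))//.
  by under eq_bigr do rewrite yE.
have := minimizer_residual_le n_gt0 lmin sy.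
rewrite (bigID (fun k : 'I_n => (k < m)%N))/=.
rewrite [leRHS](bigID (fun k : 'I_n => (k < m)%N))/=.
rewrite [X in _ <= X + _]big1 ?add0r => [|k km]; last first.
  by rewrite aggregate_cross_polytope_weight// km yE subrr expr0n.
rewrite [X in _ <= X](eq_bigr (fun k => (Y k - aggregate f l (x k)) ^+ 2)); last first.
  move=> k km; rewrite aggregate_cross_polytope_weight// (negbTE km).
  by rewrite aggregate_out_of_span// leqNgt.
rewrite gerDr => sum_le0.
have : \sum_(k < n | (k < m)%N) (Y k - aggregate f l (x k)) ^+ 2 == 0.
  by rewrite eq_le sum_le0 sumr_ge0// => k _; exact: sqr_ge0.
rewrite psumr_eq0 => [/allP/(_ i)|k _]; last exact: sqr_ge0.
by rewrite mem_index_enum im sqrf_eq0 subr_eq0 => /(_ isT)/eqP ->.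
Qed.

(** If the squared norm [Q] of the first m observations is within half of
    [q = m sigma ^ 2], they lie in the cross-polytope because
    [m Q <= 3 / 2 m ^ 2 sigma ^ 2 <= n sigma ^ 2].  The error is then
    [Q / n >= m sigma ^ 2 / (2 n)]. *)
Lemma lower_bound_deterministic (Y : 'I_n -> R) (l : 'rV[R]_M) :
  (3 * m ^ 2 <= 2 * n)%N -> (n <= 12 * m ^ 2)%N -> minimizer Y l ->
  let q := m%:R * sigma ^+ 2 in
  `|\sum_(i < n | (i < m)%N) Y i ^+ 2 - q| < q / 2 ->
  sigma ^+ 2 / Num.sqrt (48 * n%:R) <= MSE x eta (aggregate f l).
Proof.
move=> m_le m_ge lmin q; set Q := \sum_(i < n | _) _ => Qq.
have n0 : 0 < n%:R :> R by rewrite ltr0n.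
have m0 : 0 < m%:R :> R by rewrite ltr0n.
pose r : R := Num.sqrt n%:R.
have r0 : 0 < r by rewrite sqrtr_gt0.
have rr : r ^+ 2 = n%:R by rewrite sqr_sqrtr// ltW.
have m_le' : 3 * m%:R ^+ 2 <= 2 * r ^+ 2.
  by rewrite rr -natrX -!natrM ler_nat.
have m_ge' : r ^+ 2 <= 12 * m%:R ^+ 2.
  by rewrite rr -natrX -!natrM ler_nat.
have s2 : 0 < sigma ^+ 2 by rewrite exprn_gt0.
have [Qlo Qhi] : q / 2 <= Q /\ Q <= 3 / 2 * q.
  by move: Qq; rewrite ltr_distl => /andP[? ?]; split; lra.
have Ya : \sum_(i < n | (i < m)%N) `|Y i| <= sigma * r.
  (* |y| <= (c y^2 + 1/c) / 2 with the c that balances the two terms when all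
     |Y i| equal sigma r / m; this replaces the Cauchy-Schwarz inequality. *)
  pose c : R := m%:R / (sigma * r).
  have c0 : 0 < c by rewrite divr_gt0// mulr_gt0.
  apply: (@le_trans _ _ (\sum_(i < n | (i < m)%N) (c * Y i ^+ 2 + c^-1) / 2)).
    apply: ler_sum => i _; rewrite -subr_ge0.
    have -> : (c * Y i ^+ 2 + c^-1) / 2 - `|Y i| =
        c^-1 / 2 * (c * `|Y i| - 1) ^+ 2.
      by rewrite -[Y i ^+ 2]real_normK ?num_real//; field; rewrite gt_eqF.
    by rewrite mulr_ge0 ?sqr_ge0// divr_ge0// invr_ge0 ltW.
  rewrite -mulr_suml big_split/= -mulr_sumr -/Q.
  rewrite -(big_ord_widen n (fun=> c^-1) mn) sumr_const card_ord.
  have -> : c^-1 *+ m = sigma * r.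
    by rewrite -mulr_natr /c; field; rewrite !gt_eqF.
  suff : c * Q <= sigma * r by lra.
  rewrite /c mulrAC ler_pdivrMr ?mulr_gt0//.
  have : m%:R * Q <= m%:R * (3 / 2 * q) by rewrite ler_pM2l.
  rewrite /q; nra.
rewrite MSE_noise_free (bigID (fun i : 'I_n => (i < m)%N))/=.
rewrite [X in _ + X]big1 ?addr0; last first.
  by move=> i im; rewrite aggregate_out_of_span ?expr0n// leqNgt.
rewrite (eq_bigr (fun i => Y i ^+ 2)) => [|i im]; last first.
  by rewrite (aggregate_exact lmin).
rewrite -/Q -rr.
have -> : Num.sqrt (48 * r ^+ 2) = Num.sqrt 48 * r.
  by rewrite sqrtrM// sqrtr_sqr gtr0_norm.
pose t : R := Num.sqrt 48; rewrite -/t.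
have t0 : 0 < t by rewrite sqrtr_gt0.
have tt : t ^+ 2 = 48 by rewrite sqr_sqrtr.
have r_le : r <= t * m%:R / 2.
  rewrite -ler_sqr ?nnegrE ?divr_ge0 ?mulr_ge0 ?(ltW t0) ?(ltW r0) ?ler0n//.
  have -> : (t * m%:R / 2) ^+ 2 = 12 * m%:R ^+ 2.
    by rewrite expr_div_n exprMn tt; field.
  exact: m_ge'.
rewrite ler_pdivrMr ?mulr_gt0//.
have -> : r ^- 2 * Q * (t * r) = Q * t / r by field; rewrite gt_eqF.
rewrite ler_pdivlMr//.
apply: (@le_trans _ _ (sigma ^+ 2 * (t * m%:R / 2))); first by rewrite ler_pM2l.
have -> : sigma ^+ 2 * (t * m%:R / 2) = q / 2 * t by rewrite /q; ring.
by rewrite ler_pM2r.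
Qed.

(** The weights [lam w] need not be measurable in [w], but the error of the
    aggregate is a continuous function of the noise. *)
Lemma measurable_lower_bound_event d (T : measurableType d) (P : probability T R)
    (xi : 'I_n -> {RV P >-> R}) (lam : T -> 'rV[R]_M) :
  is_projection_weight x f (observation x eta xi) lam ->
  measurable (lower_bound_event x eta f sigma lam).
Proof.
move=> proj.
pose b := n%:R * (sigma ^+ 2 / Num.sqrt (48 * n%:R)).
have n0 : 0 < n%:R :> R by rewrite ltr0n.
rewrite -[X in measurable X]setCK; apply: measurableC.
have -> : ~` lower_bound_event x eta f sigma lam =
    [set w | \sum_i aggregate f (lam w) (x i) ^+ 2 < b].
  apply/seteqP; split => w; rewrite /lower_bound_event /= min_MSE_dictionary add0e
    lee_fin MSE_noise_free ler_pdivlMl// -/b.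
  - by move=> /negP; rewrite -ltNge.
  - by move=> wb; apply/negP; rewrite -ltNge.
apply: (measurable_of_open_coordinates (h := xi)) => [i|w /= wb].
  exact: measurable_funPT.
have [r r0 rP] := sum_sqr_lt_open wb.
exists (Num.sqrt (r / n%:R)) => [|w' w'w]; first by rewrite sqrtr_gt0 divr_gt0.
apply: rP; apply: le_trans (projection_contraction n_gt0 (proj w) (proj w')) _.
have -> : r = \sum_(i < n) r / n%:R.
  by rewrite sumr_const card_ord -(mulr_natr (r / n%:R)) divfK ?gt_eqF.
apply: ler_sum => i _; rewrite /observation !eta0 !add0r.
rewrite -[leLHS]real_normK ?num_real//.
rewrite -(@sqr_sqrtr _ (r / n%:R)) ?(ltW (divr_gt0 r0 n0))//.
by rewrite ler_sqr ?nnegrE ?sqrtr_ge0// ltW.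
Qed.

Lemma lower_bound_event_probability d (T : measurableType d) (P : probability T R)
    (xi : 'I_n -> {RV P >-> R}) (lam : T -> 'rV[R]_M) :
  (3 * m ^ 2 <= 2 * n)%N -> (n <= 12 * m ^ 2)%N ->
  iid_centered_normal xi sigma ->
  is_projection_weight x f (observation x eta xi) lam ->
  ((1 - 8 / m%:R)%:E <= P (lower_bound_event x eta f sigma lam))%E.
Proof.
move=> m_le m_ge iid proj.
pose J : {set 'I_n} := [set i : 'I_n | (i < m)%N]%SET.
have cardJ : #|J| = m.
  rewrite -sum1_card (eq_bigl (fun i : 'I_n => (i < m)%N)) => [|i]; last by rewrite inE.
  by rewrite -(big_ord_widen n (fun=> 1%N) mn) sum1_card card_ord.
have := sum_sqr_normal_concentration _ iid (J := J).
rewrite cardJ gt_eqF// => /(_ isT m_gt0) [mgood] /le_trans; apply.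
apply: le_measure; rewrite ?inE//.
- exact: measurable_lower_bound_event.
- move=> w /= Jw; rewrite /lower_bound_event /= min_MSE_dictionary add0e lee_fin.
  apply: lower_bound_deterministic (proj w) _ => //.
  rewrite (eq_bigr (fun i => xi i w ^+ 2)) => [|i _]; last first.
    by rewrite /observation eta0 add0r.
  by rewrite (eq_bigl (fun i => i \in J))// => i; rewrite inE.
Qed.

End Event.

(** Minimality gives [13 (m - 1) ^ 2 < 4 n], and [m >= 16] makes [m - 1] at least
    [15 m / 16], whence [3 m ^ 2 <= 2 n] with room to spare. *)
Lemma admissible_sizes_bounds (R : realType) (n m M : nat) :
  admissible_sizes R n m M ->
  [/\ (0 < n)%N, (16 <= m <= n)%N, (2 * m < M)%N, (3 * m ^ 2 <= 2 * n)%N &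
      (4 * n <= 13 * m ^ 2)%N].
Proof.
case=> n416 _ [] + mleast m16 mM.
have okE k : (4 * n%:R / 13 <= k%:R ^+ 2 :> R) = (4 * n <= 13 * k ^ 2)%N.
  by rewrite ler_pdivrMr// -natrX -!natrM ler_nat (mulnC 13%N).
rewrite okE => okm.
have nokm : (13 * m.-1 ^ 2 < 4 * n)%N.
  rewrite ltnNge -okE; apply/negP => /mleast; lia.
have m3 : (3 * m ^ 2 <= 2 * n)%N by nia.
by split => //; nia.
Qed.

Theorem proposition2p2 (R : realType) :
  (forall (n m M : nat), admissible_sizes R n m M ->
    forall (d : measure_display) (T : measurableType d) (P : probability T R)
      (sigma : R) (xi : 'I_n -> {RV P >-> R})
      (X : Type) (x : 'I_n -> X) (eta : X -> R) (f : 'I_M -> X -> R)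
      (lam : T -> 'rV[R]_M),
      0 < sigma ->
      iid_centered_normal xi sigma ->
      (forall z, eta z = 0) ->
      is_dictionary m sigma x f ->
      is_projection_weight x f (observation x eta xi) lam ->
      measurable (lower_bound_event x eta f sigma lam) /\
      ((1 / 4)%:E < P (lower_bound_event x eta f sigma lam))%E)
  /\
  (forall p : R, p < 1 -> exists n0 : nat,
    forall (n m M : nat), (n0 <= n)%N -> admissible_sizes R n m M ->
    forall (d : measure_display) (T : measurableType d) (P : probability T R)
      (sigma : R) (xi : 'I_n -> {RV P >-> R})
      (X : Type) (x : 'I_n -> X) (eta : X -> R) (f : 'I_M -> X -> R)
      (lam : T -> 'rV[R]_M),
      0 < sigma ->
      iid_centered_normal xi sigma ->
      (forall z, eta z = 0) ->
      is_dictionary m sigma x f ->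
      is_projection_weight x f (observation x eta xi) lam ->
      measurable (lower_bound_event x eta f sigma lam) /\
      (p%:E <= P (lower_bound_event x eta f sigma lam))%E).
Proof.
have bound n m M : admissible_sizes R n m M ->
    forall (d : measure_display) (T : measurableType d) (P : probability T R)
      (sigma : R) (xi : 'I_n -> {RV P >-> R})
      (X : Type) (x : 'I_n -> X) (eta : X -> R) (f : 'I_M -> X -> R)
      (lam : T -> 'rV[R]_M),
      0 < sigma -> iid_centered_normal xi sigma -> (forall z, eta z = 0) ->
      is_dictionary m sigma x f ->
      is_projection_weight x f (observation x eta xi) lam ->
      measurable (lower_bound_event x eta f sigma lam) /\
      ((1 - 8 / m%:R)%:E <= P (lower_bound_event x eta f sigma lam))%E.
  move=> /admissible_sizes_bounds[n0 /andP[m16 mn] mM m_le m_ge].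
  move=> d T P sigma xi X x eta f lam s0 iid eta0 dict proj.
  have m0 : (0 < m)%N by lia.
  split; first exact: measurable_lower_bound_event dict eta0 _ _ _ _ _ proj.
  by apply: lower_bound_event_probability dict eta0 _ _ _ _ _ _ _ iid proj => //; lia.
split=> [n m M sizes|p p1].
  have [_ /andP[m16 _] _ _ _] := admissible_sizes_bounds sizes.
  move=> d T P sigma xi X x eta f lam s0 iid eta0 dict proj.
  have [mE PE] := bound _ _ _ sizes _ _ _ _ _ _ _ _ _ _ s0 iid eta0 dict proj.
  split=> //; apply: lt_le_trans PE; rewrite lte_fin.
  have m16' : 16%:R <= m%:R :> R by rewrite ler_nat.
  rewrite ltrBrDr -ltrBrDl ltr_pdivrMr; lra.
(* From n >= 4 K^2 and 4 n <= 13 m^2 follows m >= K. *)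
pose K := Num.bound (8 / (1 - p)).
exists (4 * K ^ 2)%N => n m M n0 sizes.
have [_ /andP[m16 _] _ _ m_ge] := admissible_sizes_bounds sizes.
move=> d T P sigma xi X x eta f lam s0 iid eta0 dict proj.
have [mE PE] := bound _ _ _ sizes _ _ _ _ _ _ _ _ _ _ s0 iid eta0 dict proj.
split=> //; apply: le_trans PE; rewrite lee_fin.
have Km : (K <= m)%N by nia.
have p0 : 0 < 1 - p by rewrite subr_gt0.
have m0 : 0 < m%:R :> R by rewrite ltr0n; lia.
have : 8 / (1 - p) <= m%:R.
  apply: (@le_trans _ _ K%:R); last by rewrite ler_nat.
  by apply/ltW/archi_boundP; rewrite divr_ge0// ltW.
rewrite ler_pdivrMr// => hm.
have : 8 / m%:R <= 1 - p by rewrite ler_pdivrMr// mulrC.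
lra.
Qed.
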